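(* A unit interval graph is $2$-nested (that is, has peak-nesting at most $2$) if and only if it is the line graph of a triangle-free multigraph.
   Context: Graphs are finite and are identified up to isomorphism when saying that a graph is a line graph. Write $[n]=\{1,\dots,n\}$. An area sequence of size $n$ is a sequence $\mathbf a=(a_1,\dots,a_n)$ of nonnegative integers with $a_i<i$ for all $i$ and $a_i\le a_{i-1}+1$ for all $i\ge 2$. It defines a graph $\Gamma_{\mathbf a}$ on $[n]$ with edges $\{j,i\}$ for $1\le j<i\le n$ with $i-a_i\le j$; unit interval graphs (on $[n]$) are the graphs $\Gamma_{\mathbf a}$. If $\{i,j\}$ with $i<j$ is an edge then $\{i,i+1,\dots,j\}$ is a clique. A peak-edge of $\Gamma_{\mathbf a}$ is either an isolated vertex $i$ (put $j=i$) or an edge $\{i,j\}$, $i<j$, such that neither $\{i,j+1\}$ nor $\{i-1,j\}$ is an edge (pairs not contained in $[n]$ are not edges). The corresponding peak-clique is $\{i,\dots,j\}$. The peak-nesting of a vertex is the number of peak-cliques containing it, and the peak-nesting of $\Gamma_{\mathbf a}$ is the maximum over all vertices. A multigraph is a pair $(V,F)$ with $V$ a set (the vertex set) and $F$ a multiset of elements of $\binom V1\cup\binom V2$ (the edge set; so loops and parallel edges are allowed). Its line graph is the graph whose vertices are the elements of $F$ (counted with multiplicity), two distinct ones being adjacent if and only if they share a common vertex of $V$. A multigraph is called triangle-free if it does not contain a triangle as an induced subgraph.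
   Formalization: ''Triangle-free'' here means no three distinct pairwise adjacent vertices, whatever loops or parallel edges they carry; with the literal ''induced triangle'' the claim fails: a triangle with loops at two vertices has as line graph the square of the 5-vertex path, of peak-nesting 3. *)

(* Defs.v *)
From mathcomp Require Import all_boot finmap multiset.

Set Implicit Arguments.
Unset Strict Implicit.
Unset Printing Implicit Defensive.

Local Open Scope mset_scope.

Record simple_graph (T : finType) := SimpleGraph {
  adj :> rel T;
  adj_sym : symmetric adj;
  adj_irrefl : irreflexive adj
}.

Definition isomorphic (T U : finType)
    (G : simple_graph T) (H : simple_graph U) : Prop :=
  exists f : T -> U, bijective f /\ forall x y, H (f x) (f y) = G x y.

(* Throughout, the element i : 'I_n stands for the vertex i.+1 of
   [n] = {1, ..., n}. Hence the condition a_i < i reads a i < i.+1; the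
   conditions on differences of vertices are invariant under the shift. *)
Definition area_sequence (n : nat) (a : 'I_n -> nat) : Prop :=
  (forall i : 'I_n, a i < i.+1) /\
  (forall i j : 'I_n, i = j.+1 :> nat -> a i <= (a j).+1).

Definition area_adj (n : nat) (a : 'I_n -> nat) : rel 'I_n :=
  fun i j => ((j < i) && (i - a i <= j)) || ((i < j) && (j - a j <= i)).

Lemma area_adj_sym (n : nat) (a : 'I_n -> nat) : symmetric (area_adj a).
Proof. by move=> i j; rewrite /area_adj orbC. Qed.

Lemma area_adj_irrefl (n : nat) (a : 'I_n -> nat) : irreflexive (area_adj a).
Proof. by move=> i; rewrite /area_adj ltnn. Qed.

Definition unit_interval_graph (n : nat) (a : 'I_n -> nat) : simple_graph 'I_n :=
  SimpleGraph (area_adj_sym a) (area_adj_irrefl a).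

(* The last two conjuncts are vacuous when j.+1, respectively i.-1, falls
   outside the vertex range: such pairs are not edges. *)
Definition peak_edge (n : nat) (G : simple_graph 'I_n) (i j : 'I_n) : bool :=
  ((i == j) && [forall k, ~~ G i k]) ||
  [&& i < j, G i j,
      [forall k : 'I_n, (k == j.+1 :> nat) ==> ~~ G i k] &
      [forall k : 'I_n, (k.+1 == i :> nat) ==> ~~ G k j]].

Definition peak_clique (n : nat) (i j : 'I_n) : {set 'I_n} :=
  [set k : 'I_n | i <= k <= j].

Definition peak_cliques (n : nat) (G : simple_graph 'I_n) : {set {set 'I_n}} :=
  [set peak_clique p.1 p.2 | p : 'I_n * 'I_n & peak_edge G p.1 p.2].

Definition vertex_peak_nesting (n : nat) (G : simple_graph 'I_n) (v : 'I_n) : nat :=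
  #|[set C in peak_cliques G | v \in C]|.

Definition peak_nesting (n : nat) (G : simple_graph 'I_n) : nat :=
  \max_(v < n) vertex_peak_nesting G v.

(* An edge is its set of endpoints: a loop is a singleton. *)
Record multigraph := Multigraph {
  mg_vertex : finType;
  mg_edges : {mset {set mg_vertex}};
  mg_edges_card : forall e, e \in mg_edges -> 1 <= #|e| <= 2
}.

(* Elements of the multiset counted with multiplicity: pairs of an edge e
   and the index of one of its mg_edges M e copies. *)
Definition edge_copy (M : multigraph) : finType :=
  {e : {set mg_vertex M} & 'I_(mg_edges M e)}.

Definition line_adj (M : multigraph) : rel (edge_copy M) :=
  fun x y => (x != y) && (tag x :&: tag y != set0).

Lemma line_adj_sym (M : multigraph) : symmetric (@line_adj M).
Proof. by move=> x y; rewrite /line_adj eq_sym setIC. Qed.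

Lemma line_adj_irrefl (M : multigraph) : irreflexive (@line_adj M).
Proof. by move=> x; rewrite /line_adj eqxx. Qed.

Definition line_graph (M : multigraph) : simple_graph (edge_copy M) :=
  SimpleGraph (@line_adj_sym M) (@line_adj_irrefl M).

(* Three distinct, pairwise adjacent vertices form a triangle, whatever the
   multiplicities of the edges between them and the loops at them. Requiring
   single edges and no loops would be too weak: the square of a path on five
   vertices is the line graph of a triangle with a loop at two of its
   vertices, yet has peak-nesting 3. *)
Definition triangle_free (M : multigraph) : Prop :=
  forall u v w : mg_vertex M, u != v -> v != w -> u != w ->
  ~ [/\ [set u; v] \in mg_edges M, [set v; w] \in mg_edges M
      & [set u; w] \in mg_edges M].

(* Main.v *)
(* If the peak-nesting is at most 2, send each vertex to the set of peak-cliques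
   containing it: this is an edge (or a loop) of a multigraph on the
   peak-cliques, and two vertices are adjacent exactly when they share a
   peak-clique. A triangle would consist of three pairwise intersecting
   peak-cliques, hence (Helly) of three peak-cliques through a common vertex.

   Conversely, let v lie in three peak-cliques [x, r], [y, z], [t, w], listed
   from left to right. Then x, y, v, z, w induce the square of a path, which is
   not an induced subgraph of the line graph of a triangle-free multigraph. *)

Require Import Defs.
From mathcomp Require Import all_boot finmap multiset.
From mathcomp Require Import zify.

Set Implicit Arguments.
Unset Strict Implicit.
Unset Printing Implicit Defensive.

Local Open Scope mset_scope.

(** * Line graphs *)

Section FamilyMultigraph.

Variables (T V : finType) (f : T -> {set V}).
Hypothesis card_f : forall x, 1 <= #|f x| <= 2.

Lemma mem_codom_mset (e : {set V}) :
  (e \in seq_mset (codom f)) = (e \in codom f).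
Proof. by rewrite (perm_mem (perm_eq_seq_mset _)). Qed.

Lemma family_edges_card (e : {set V}) :
  e \in seq_mset (codom f) -> 1 <= #|e| <= 2.
Proof. by rewrite mem_codom_mset => /codomP[x ->]. Qed.

(** [codom f] keeps repetitions, so elements of [T] with the same value under [f] give parallel
    edges. *)
Definition family_multigraph : multigraph := Multigraph family_edges_card.

Lemma family_edges_mult (e : {set V}) :
  mg_edges family_multigraph e = #|[pred x | f x == e]|.
Proof. by rewrite mset_seqE count_map cardE enumT size_filter. Qed.

(** The multiplicity of an edge is the size of its fibre under [f], so the index of a copy is read
    as a position in the enumeration of that fibre. *)
Definition edge_copy_owner (c : edge_copy family_multigraph) : T :=
  enum_val (cast_ord (family_edges_mult (tag c)) (tagged c)).

Lemma tag_edge_copy_owner c : f (edge_copy_owner c) = tag c.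
Proof.
exact: eqP (enum_valP (cast_ord (family_edges_mult (tag c)) (tagged c))).
Qed.

Lemma edge_copy_owner_inj : injective edge_copy_owner.
Proof.
move=> c d eq_cd; have := tag_edge_copy_owner c.
rewrite eq_cd tag_edge_copy_owner => eq_tag.
(* The type of the index depends on the edge, so the edges are identified before the indices are
   compared. *)
case: c d eq_tag eq_cd => [e i] [e' j] /= eq_e; case: _ / eq_e in i * => eq_ij.
by congr existT; apply: (@cast_ord_inj _ _ (family_edges_mult e')); apply: enum_val_inj.
Qed.

Lemma edge_copy_owner_bij : bijective edge_copy_owner.
Proof.
have x_in x : x \in [pred y | f y == f x] by rewrite inE.
pose h x : edge_copy family_multigraph :=
  existT _ (f x) (cast_ord (esym (family_edges_mult (f x)))
                    (enum_rank_in (x_in x) x)).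
have hK : cancel h edge_copy_owner.
  by move=> x; rewrite /edge_copy_owner /= cast_ordKV enum_rankK_in.
by exists h => //; exact: inj_can_sym hK edge_copy_owner_inj.
Qed.

Lemma family_multigraph_iso (G : simple_graph T) :
  (forall x y, G x y = (x != y) && (f x :&: f y != set0)) ->
  isomorphic G (line_graph family_multigraph).
Proof.
move=> GE; case: edge_copy_owner_bij => h ownerK hK.
exists h; split; first by exists edge_copy_owner.
move=> x y /=; rewrite /line_adj GE (inj_eq (can_inj hK)).
by rewrite -!tag_edge_copy_owner !hK.
Qed.

End FamilyMultigraph.

Lemma tag_edge_copy_mem (M : multigraph) (c : edge_copy M) : tag c \in mg_edges M.
Proof. by rewrite in_mset; exact: leq_ltn_trans (ltn_ord (tagged c)). Qed.

Lemma edge_of_two_endpoints (M : multigraph) (c : edge_copy M) (p q : mg_vertex M) :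
  p != q -> p \in tag c -> q \in tag c -> tag c = [set p; q].
Proof.
move=> neq_pq p_c q_c; apply/esym/eqP; rewrite eqEcard subUset !sub1set p_c q_c /=.
by rewrite cards2 neq_pq; case/andP: (mg_edges_card (tag_edge_copy_mem c)).
Qed.

(* The five vertices induce the square of a path. As [x] and [z] are disjoint,
   [v] is an edge [{p, q}] with [p] in [x] and [q] in [z]; then [y] and [z]
   are the edges [{p, r}] and [{q, r}]. *)
Lemma line_graph_square_P5_free (M : multigraph) (x y v z w : edge_copy M) :
  triangle_free M ->
  let G := line_graph M in
  x != z -> x != w -> y != w ->
  G x v -> G y v -> G y z -> G v z -> G v w ->
  ~~ G x z -> ~~ G x w -> ~~ G y w -> False.
Proof.
(* Only for distinct copies does non-adjacency mean disjointness; the three inequalities serve this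
   purpose. *)
move=> tfM G; rewrite /G /= /line_adj => -> -> -> /=.
case/andP=> _ /set0Pn[p /setIP[p_x p_v]].
case/andP=> _ /set0Pn[s /setIP[s_y s_v]].
case/andP=> _ /set0Pn[r /setIP[r_y r_z]].
case/andP=> _ /set0Pn[q /setIP[q_v q_z]].
case/andP=> _ /set0Pn[t /setIP[t_v t_w]].
have disj (A B : {set mg_vertex M}) u : ~~ (A :&: B != set0) -> u \in A -> u \in B -> False.
  by rewrite negbK setI_eq0 => /pred0P/(_ u) /= AB uA uB; rewrite uA uB in AB.
move=> xz xw yw.
have neq_pq : p != q by apply/eqP => pq; apply: disj xz p_x _; rewrite pq.
have vE := edge_of_two_endpoints neq_pq p_v q_v.
(* [v] can meet [w] only in [p] or [q], and [p] would lie in the disjoint edges [x] and [w]. *)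
have q_w : q \in tag w.
  move: t_v; rewrite vE => /set2P[tp|<- //].
  by case: (disj _ _ p xw p_x); rewrite -tp.
have p_y : p \in tag y.
  move: s_v; rewrite vE => /set2P[<- //|sq].
  by case: (disj _ _ q yw _ q_w); rewrite -sq.
have neq_pr : p != r by apply/eqP => pr; apply: disj xz p_x _; rewrite pr.
have neq_qr : q != r by apply/eqP => qr; apply: disj yw _ q_w; rewrite qr.
apply: (tfM p q r) => //; split.
- by rewrite -vE tag_edge_copy_mem.
- by rewrite -(edge_of_two_endpoints neq_qr q_z r_z) tag_edge_copy_mem.
- by rewrite -(edge_of_two_endpoints neq_pr p_y r_y) tag_edge_copy_mem.
Qed.

(** * Peak-cliques of unit interval graphs *)

Section UnitInterval.

Variables (n : nat) (a : 'I_n -> nat).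
Hypothesis area_a : area_sequence a.

Let G := unit_interval_graph a.

(** The least vertex equal or adjacent to [j]; the area condition makes the truncated subtraction
    exact. *)
Definition leftmost (j : 'I_n) : nat := j - a j.

Lemma leftmost_le (j : 'I_n) : leftmost j <= j.
Proof. exact: leq_subr. Qed.

(** The bound on consecutive values of [a] is the case of distance one; induction on [j - i] does
    the rest. *)
Lemma leftmost_mono (i j : 'I_n) : i <= j -> leftmost i <= leftmost j.
Proof.
move: {2}(j - i) (erefl (j - i)) => d; elim: d j => [|d IHd] j dE le_ij.
  by rewrite (_ : i = j) //; apply: val_inj => /=; lia.
have lt_j : j.-1 < n by have := ltn_ord j; lia.
have jE : j = (Ordinal lt_j).+1 :> nat by rewrite /=; lia.
have := IHd (Ordinal lt_j); rewrite /= => /(_ ltac:(lia) ltac:(lia)).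
have := area_a.2 j (Ordinal lt_j) jE; rewrite /leftmost /=; lia.
Qed.

Lemma adj_ltnE (i j : 'I_n) : i < j -> G i j = (leftmost j <= i).
Proof. by move=> lt_ij; rewrite /G /= /area_adj lt_ij ltnNge (ltnW lt_ij). Qed.

(* With [leftmost] monotone, the interval below [j] is a maximal clique exactly
   when [leftmost] increases right after [j]. *)
Lemma peak_edgeP (i j : 'I_n) :
  reflect (i = leftmost j :> nat /\
           forall k : 'I_n, k = j.+1 :> nat -> leftmost j < leftmost k)
          (peak_edge G i j).
Proof.
apply: (iffP orP).
- case=> [/andP[/eqP <- /forallP iso_i]|/and4P[lt_ij adj_ij /forallP Hj /forallP Hi]].
  + have le_i (k : 'I_n) : leftmost i <= k -> k <= i -> k = i.
      move=> le_k le_ki; apply/eqP/negPn/negP => neq_ki.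
      have lt_ki : k < i by rewrite ltn_neqAle neq_ki.
      by move: (iso_i k); rewrite adj_sym adj_ltnE // le_k.
    have lE : i = leftmost i :> nat.
      have lt_l := leq_ltn_trans (leftmost_le i) (ltn_ord i).
      by rewrite -{1}(le_i (Ordinal lt_l) _ (leftmost_le i)).
    split=> // k kE; move: (iso_i k); rewrite adj_ltnE; lia.
  + rewrite adj_ltnE // in adj_ij.
    have lE : i = leftmost j :> nat.
      apply/eqP; rewrite eqn_leq adj_ij andbT leqNgt; apply/negP => lt_l.
      have lt_i : i.-1 < n by have := ltn_ord i; lia.
      have := Hi (Ordinal lt_i); rewrite adj_ltnE /=; lia.
    split=> // k kE; have := Hj k; rewrite kE eqxx adj_ltnE /=; lia.
- case=> iE Hk; have le_ij : i <= j by rewrite iE leftmost_le.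
  case: (ltngtP i j) le_ij => // [lt_ij _|/val_inj eq_ij _].
  + right; apply/and4P; split=> //.
    * by rewrite adj_ltnE // -iE.
    * apply/forallP => k; apply/implyP => /eqP kE; rewrite adj_ltnE; last lia.
      by rewrite -ltnNge iE Hk.
    * apply/forallP => k; apply/implyP => /eqP kE; rewrite adj_ltnE; lia.
  + left; rewrite eq_ij eqxx andTb; apply/forallP => k.
    case: (ltngtP k j) => [lt_kj|lt_jk|/val_inj ->]; last by rewrite adj_irrefl.
      by rewrite adj_sym adj_ltnE // -ltnNge -iE eq_ij.
    (* Monotonicity carries the strict increase at [j.+1] over to every later [k]. *)
    have lt_j : j.+1 < n by exact: leq_ltn_trans (ltn_ord k).
    have := Hk (Ordinal lt_j) erefl; have := @leftmost_mono (Ordinal lt_j) k lt_jk.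
    by rewrite adj_ltnE // -iE eq_ij -ltnNge => le_k lt_k; exact: leq_trans le_k.
Qed.

Lemma mem_peak_cliques (C : {set 'I_n}) :
  reflect (exists i j, peak_edge G i j /\ C = peak_clique i j)
          (C \in peak_cliques G).
Proof.
apply: (iffP imsetP) => [[[i j]]|[i [j [ij ->]]]].
  by rewrite inE /= => ij ->; exists i, j.
by exists (i, j); rewrite ?inE.
Qed.

(** The clique ends at the last [j] with [leftmost j <= u]. The case [u = v] puts every vertex in
    some peak-clique. *)
Lemma peak_clique_exists (u v : 'I_n) : u <= v -> leftmost v <= u ->
  exists2 C, C \in peak_cliques G & (u \in C) && (v \in C).
Proof.
move=> le_uv le_vu; pose P (j : 'I_n) := leftmost j <= u.
have Pv : P v by [].
case: (@arg_maxnP _ v P (@nat_of_ord n) Pv) => j Pj j_max.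
have lt_l := leq_ltn_trans (leftmost_le j) (ltn_ord j).
have le_vj := j_max v Pv.
exists (peak_clique (Ordinal lt_l) j).
  apply/mem_peak_cliques; exists (Ordinal lt_l), j; split=> //.
  apply/peak_edgeP; split=> // k kE; rewrite ltnNge; apply/negP => le_k.
  have := j_max k (leq_trans le_k Pj); rewrite kE; lia.
rewrite !inE /=; rewrite /P in Pj; lia.
Qed.

Lemma adj_peak_cliques (u v : 'I_n) :
  G u v = (u != v) && [exists C in peak_cliques G, (u \in C) && (v \in C)].
Proof.
wlog lt_uv: u v / u < v => [th|].
  case: (ltngtP u v) => [|lt_vu|/val_inj ->]; first exact: th.
    rewrite adj_sym th // eq_sym; congr (_ && _).
    by apply: eq_existsb => C; rewrite (andbC (v \in C)).
  by rewrite adj_irrefl eqxx.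
rewrite adj_ltnE // neq_ltn lt_uv /=; apply/idP/exists_inP.
  exact: peak_clique_exists (ltnW lt_uv).
case=> C /mem_peak_cliques[i [j [/peak_edgeP[iE _] ->]]].
rewrite !inE => /andP[/andP[le_iu _] /andP[_ le_vj]].
by rewrite (leq_trans (leftmost_mono le_vj)) // -iE.
Qed.

(** For pairwise intersecting intervals, the largest left endpoint lies in all three. *)
Lemma peak_cliques_helly (A B C : {set 'I_n}) :
  A \in peak_cliques G -> B \in peak_cliques G -> C \in peak_cliques G ->
  A :&: B != set0 -> B :&: C != set0 -> A :&: C != set0 ->
  exists v, [/\ v \in A, v \in B & v \in C].
Proof.
move=> /mem_peak_cliques[i [j [_ ->]]] /mem_peak_cliques[i' [j' [_ ->]]].
move=> /mem_peak_cliques[k [l [_ ->]]].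
case/set0Pn=> p; rewrite !inE => pP.
case/set0Pn=> q; rewrite !inE => qP.
case/set0Pn=> r; rewrite !inE => rP.
have [h1|h1] := leqP i i'; have [h2|h2] := leqP i k; have [h3|h3] := leqP i' k;
  by [exists i; rewrite !inE; split; lia | exists i'; rewrite !inE; split; lia
     | exists k; rewrite !inE; split; lia].
Qed.

Lemma two_nested_line_graph : peak_nesting G <= 2 ->
  exists M : multigraph, triangle_free M /\ isomorphic G (line_graph M).
Proof.
move=> nested; pose f v := [set C in peak_cliques G | v \in C].
have le_f v : #|f v| <= 2.
  exact: leq_trans (leq_bigmax v) nested.
have card_f v : 1 <= #|f v| <= 2.
  rewrite le_f andbT card_gt0; apply/set0Pn.
  case: (peak_clique_exists (leqnn v) (leftmost_le v)) => C C_peak /andP[vC _].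
  by exists C; rewrite inE C_peak.
(* The vertices are all subsets of ['I_n]; those that are not peak-cliques lie on no edge. *)
exists (family_multigraph card_f); split; last first.
  apply: family_multigraph_iso => u v; rewrite adj_peak_cliques; congr (_ && _).
  apply/exists_inP/set0Pn => [[C C_peak /andP[uC vC]]|[C]].
    by exists C; rewrite !inE C_peak uC.
  by rewrite !inE => /andP[/andP[? ?] /andP[_ ?]]; exists C => //; apply/andP.
move=> A B C /= neq_AB neq_BC neq_AC; rewrite !mem_codom_mset.
case=> /codomP[x xE] /codomP[y yE] /codomP[z zE].
have peak_inter (P Q : {set 'I_n}) v : [set P; Q] = f v ->
    [/\ P \in peak_cliques G, Q \in peak_cliques G & P :&: Q != set0].
  move=> fE; have := set21 P Q; have := set22 P Q.
  rewrite fE !inE => /andP[-> vQ] /andP[-> vP]; split=> //.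
  by apply/set0Pn; exists v; rewrite inE vP.
case: (peak_inter _ _ _ xE) (peak_inter _ _ _ yE) (peak_inter _ _ _ zE).
move=> A_peak B_peak AB [_ C_peak BC] [_ _ AC].
case: (peak_cliques_helly A_peak B_peak C_peak AB BC AC) => v [vA vB vC].
have: 2 < #|f v|.
  apply/card_gt2P; exists A, B, C; split; rewrite ?inE ?A_peak ?B_peak ?C_peak //.
  by split; rewrite // eq_sym.
by rewrite ltnNge le_f.
Qed.

(** [leftmost] jumps right after [j] and never decreases afterwards. *)
Lemma peak_edges_lt (i i' j j' : 'I_n) :
  peak_edge G i j -> peak_edge G i' j' -> j < j' -> i < i'.
Proof.
move=> /peak_edgeP[-> Hj] /peak_edgeP[-> _] lt_jj'.
have lt_j : j.+1 < n by exact: leq_ltn_trans (ltn_ord j').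
exact: leq_trans (Hj (Ordinal lt_j) erefl) (@leftmost_mono (Ordinal lt_j) j' lt_jj').
Qed.

Lemma line_graph_not_three_nested (M : multigraph) :
  triangle_free M -> isomorphic G (line_graph M) ->
  forall (i1 j1 i2 j2 i3 j3 v : 'I_n),
  peak_edge G i1 j1 -> peak_edge G i2 j2 -> peak_edge G i3 j3 ->
  j1 < j2 -> j2 < j3 -> i3 <= v -> v <= j1 -> False.
Proof.
move=> tfM [h [h_bij hG]] i1 j1 i2 j2 i3 j3 v pk1 pk2 pk3 lt12 lt23 le_v v_le.
have lt_i12 := peak_edges_lt pk1 pk2 lt12; have lt_i23 := peak_edges_lt pk2 pk3 lt23.
case/peak_edgeP: pk1 pk2 pk3 => iE1 _ /peak_edgeP[iE2 _] /peak_edgeP[iE3 _].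
have mono1 := leftmost_mono v_le.
have mono2 := leftmost_mono (ltnW lt12); have mono3 := leftmost_mono (ltnW lt23).
(* Here [i1 < i2 < i3 <= v <= j1 < j2 < j3]. The non-edges hold because [j2] and [j3] reach left
   only to [i2] and [i3]; [v] reaches [i1] because [j1] does. *)
apply: (@line_graph_square_P5_free M (h i1) (h i2) (h v) (h j2) (h j3) tfM);
  rewrite ?hG ?(inj_eq (bij_inj h_bij)) ?neq_ltn ?adj_ltnE /=; lia.
Qed.

Lemma line_graph_two_nested (M : multigraph) :
  triangle_free M -> isomorphic G (line_graph M) -> peak_nesting G <= 2.
Proof.
move=> tfM isoM; apply/bigmax_leqP => v _; rewrite leqNgt; apply/negP.
case/card_gt2P=> A [B [C [[]]]]; rewrite !inE.
move=> /andP[/mem_peak_cliques[i1 [j1 [pk1 ->]]]]; rewrite inE => /andP[le1 ge1].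
move=> /andP[/mem_peak_cliques[i2 [j2 [pk2 ->]]]]; rewrite inE => /andP[le2 ge2].
move=> /andP[/mem_peak_cliques[i3 [j3 [pk3 ->]]]]; rewrite inE => /andP[le3 ge3].
(* The right endpoint determines a peak-clique, so distinct peak-cliques can be ordered by it. *)
have neq_j (i i' j j' : 'I_n) : peak_edge G i j -> peak_edge G i' j' ->
    peak_clique i j != peak_clique i' j' -> j != j' :> nat.
  move=> /peak_edgeP[iE _] /peak_edgeP[iE' _]; apply: contraNneq => /val_inj eq_j.
  by rewrite eq_j (_ : i = i') //; apply: val_inj; rewrite /= iE iE' eq_j.
case=> /(neq_j _ _ _ _ pk1 pk2) n12 /(neq_j _ _ _ _ pk2 pk3) n23 /(neq_j _ _ _ _ pk3 pk1) n31.
have main := line_graph_not_three_nested tfM isoM.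
(* Of the eight sign patterns, [lia] discards the two cyclic ones; six orders remain. *)
case: (ltngtP j1 j2) n12 => // lt12 _; case: (ltngtP j2 j3) n23 => // lt23 _;
  case: (ltngtP j3 j1) n31 => // lt31 _; try lia.
- exact: (main _ _ _ _ _ _ v pk1 pk2 pk3).
- exact: (main _ _ _ _ _ _ v pk3 pk1 pk2).
- exact: (main _ _ _ _ _ _ v pk1 pk3 pk2).
- exact: (main _ _ _ _ _ _ v pk2 pk3 pk1).
- exact: (main _ _ _ _ _ _ v pk2 pk1 pk3).
- exact: (main _ _ _ _ _ _ v pk3 pk2 pk1).
Qed.

End UnitInterval.

Theorem proposition5p2 (n : nat) (a : 'I_n -> nat) (ha : area_sequence a) :
  peak_nesting (unit_interval_graph a) <= 2 <->
  exists M : multigraph,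
    triangle_free M /\ isomorphic (unit_interval_graph a) (line_graph M).
Proof.
split; first exact: two_nested_line_graph.
by case=> M [tfM isoM]; exact: line_graph_two_nested isoM.
Qed.
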